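(* There is an absolute constant $C>0$ such that the following holds. Let $H_0,H_1,\mu>0$, and let $f:\mathbb{R}^d\to\mathbb{R}$ be $(H_0,H_1)$-smooth and $\mu$-strongly convex. Let $\theta=\frac1{4\sqrt2+4}$, and let $(x^k)_{k\ge0}$ be generated by gradient descent with the warm-up step size $\eta_k=\theta\min\left\{\frac1{H_0},\frac1{3H_1F_k}\right\}$, where $F_k=f(x^k)-f^*$. Then for every $\varepsilon\in(0,F_0)$ and every integer $$N\ge C\left(\frac{H_0}{\theta\mu}\log\left(\frac{F_0}{\varepsilon}\right)+\frac{H_1F_0}{\theta\mu}\right)$$ one has $f(x^N)-f^*\le\varepsilon$.
   Context: $f$ is differentiable on $\mathbb{R}^d$ and $f^*=\min_xf(x)$; $\|\cdot\|$ is the Euclidean norm. $(H_0,H_1)$-smoothness: for all $x,y\in\mathbb{R}^d$ with $\|y-x\|\le1/\sqrt{H_1}$, $\|\nabla f(y)-\nabla f(x)\|\le\big(H_0+H_1[f(x)-f^*]\big)\|y-x\|$. $\mu$-strong convexity: $f(x)-f(y)+\frac\mu2\|x-y\|^2\le\langle\nabla f(x),x-y\rangle$ for all $x,y\in\mathbb{R}^d$. Gradient descent: $x^0\in\mathbb{R}^d$ is given and $x^{k+1}=x^k-\eta_k\nabla f(x^k)$ for $k\ge0$, with the convention $\frac1{3H_1F_k}=+\infty$ (so $\eta_k=\theta/H_0$) when $F_k=0$. *)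

(* Defs.v *)
From HB Require Import structures.
From mathcomp Require Import all_boot all_order all_algebra.
From mathcomp Require Import all_classical all_reals all_analysis.
Import Order.TTheory GRing.Theory Num.Theory.
Import numFieldNormedType.Exports.

Set Implicit Arguments.
Unset Strict Implicit.
Unset Printing Implicit Defensive.

Local Open Scope ring_scope.

(* Points of R^d are row vectors.  The library norm
   `|x| on 'rV[R]_d is the sup norm, hence the explicit Euclidean norm below;
   the two induce the same topology on R^d, so the library predicate
   [differentiable] is the usual one. *)

Definition dotprod (R : realType) (d : nat) (u v : 'rV[R]_d) : R :=
  \sum_(i < d) u 0 i * v 0 i.

Definition enorm (R : realType) (d : nat) (u : 'rV[R]_d) : R :=
  Num.sqrt (dotprod u u).

Definition grad (R : realType) (d : nat) (f : 'rV[R]_d -> R) (x : 'rV[R]_d) :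
    'rV[R]_d :=
  \row_(i < d) 'D_(delta_mx 0 i) f x.

Definition is_min_value (R : realType) (d : nat) (f : 'rV[R]_d -> R)
    (fstar : R) : Prop :=
  (exists x, f x = fstar) /\ (forall x, fstar <= f x).

Definition H0H1_smooth (R : realType) (d : nat) (f : 'rV[R]_d -> R)
    (fstar H0 H1 : R) : Prop :=
  forall x y : 'rV[R]_d, enorm (y - x) <= 1 / Num.sqrt H1 ->
    enorm (grad f y - grad f x) <= (H0 + H1 * (f x - fstar)) * enorm (y - x).

Definition strongly_convex (R : realType) (d : nat) (f : 'rV[R]_d -> R)
    (mu : R) : Prop :=
  forall x y : 'rV[R]_d,
    f x - f y + mu / 2 * enorm (x - y) ^+ 2 <= dotprod (grad f x) (x - y).

Definition theta (R : realType) : R := 1 / (4 * Num.sqrt 2 + 4).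

(* The case F = 0 implements the convention 1 / (3 H1 F) = +oo; without it,
   the convention 1 / 0 = 0 of MathComp would make the step vanish. *)
Definition warmup_step (R : realType) (th H0 H1 F : R) : R :=
  th * (if F == 0 then 1 / H0 else Num.min (1 / H0) (1 / (3 * H1 * F))).

Definition gradient_descent (R : realType) (d : nat) (f : 'rV[R]_d -> R)
    (eta : nat -> R) (x : nat -> 'rV[R]_d) : Prop :=
  forall k : nat, x k.+1 = x k - eta k *: grad f (x k).

(* Main.v *)
Require Import Defs.
From HB Require Import structures.
From mathcomp Require Import all_boot all_order all_algebra.
From mathcomp Require Import all_classical all_reals all_analysis.
From mathcomp Require Import ring lra.
Import Order.TTheory GRing.Theory Num.Theory.
Import numFieldNormedType.Exports.
Local Open Scope ring_scope.

(** Write [F] for the gap [f x - fstar], [g] for the gradient at [x] and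
    [L = H0 + H1 F].  Within distance [1 / sqrt H1] of [x], the convexity
    inequality at the endpoint, [f y - f x <= <grad f y, y - x>], together with
    the smoothness bound on [grad f y - g] gives the descent inequality
    [f y <= f x + <g, y - x> + L |y - x|^2] ([descent]) without integrating
    along the segment.  Comparing it with [fstar <= f y] bounds the gradient,
    [|g|^2 <= 4 L F] ([grad_sqr_le]), so the warm-up step stays inside that
    ball, and it satisfies [eta L <= 1 / 2].  Hence one step decreases [f] by
    at least [eta / 2 |g|^2], and strong convexity ([PL_inequality]) turns this
    into [F' <= F - eta mu F] ([gd_step]).

    The two regimes of the step size are handled at once by the potential
    [(H0 ln F + 3 H1 F) / (theta mu)].  If [eta = theta / H0], then [ln F]
    decreases by at least [theta mu / H0]; if [eta = theta / (3 H1 F)], then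
    [F] decreases by at least [theta mu / (3 H1)].  Either way the potential
    drops by at least one ([potential_step]), so the gap cannot remain above
    [eps] for longer than the announced number of steps, with [C = 3]. *)

(** * Euclidean inner product *)

Lemma dotprodC (R : realType) d (u v : 'rV[R]_d) : dotprod u v = dotprod v u.
Proof. by apply: eq_bigr => i _; rewrite mulrC. Qed.

Lemma dotprodDl (R : realType) d (u v w : 'rV[R]_d) :
  dotprod (u + v) w = dotprod u w + dotprod v w.
Proof. by rewrite -big_split; apply: eq_bigr => i _; rewrite mxE mulrDl. Qed.

Lemma dotprodZl (R : realType) d (a : R) (u w : 'rV[R]_d) :
  dotprod (a *: u) w = a * dotprod u w.
Proof.
by rewrite /dotprod mulr_sumr; apply: eq_bigr => i _; rewrite mxE mulrA.
Qed.

Lemma dotprodZr (R : realType) d (a : R) (u w : 'rV[R]_d) :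
  dotprod u (a *: w) = a * dotprod u w.
Proof. by rewrite dotprodC dotprodZl dotprodC. Qed.

Lemma dotprod_ge0 (R : realType) d (u : 'rV[R]_d) : 0 <= dotprod u u.
Proof. by apply: sumr_ge0 => i _; rewrite -expr2 sqr_ge0. Qed.

Lemma enorm_sqr (R : realType) d (u : 'rV[R]_d) : enorm u ^+ 2 = dotprod u u.
Proof. by rewrite sqr_sqrtr // dotprod_ge0. Qed.

(** Expansion of [|u - a v|^2 >= 0]; the choice of [a] takes the place of the
    Cauchy-Schwarz inequality. *)
Lemma dotprod_young (R : realType) d (a : R) (u v : 'rV[R]_d) :
  2 * a * dotprod u v <= dotprod u u + a ^+ 2 * dotprod v v.
Proof.
have := dotprod_ge0 _ _ (u + (- a) *: v).
rewrite dotprodDl dotprodZl !(dotprodC _ _ _ (u + _)) !dotprodDl !dotprodZl.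
rewrite (dotprodC _ _ v u); lra.
Qed.

Lemma dotprod_le_of_enorm_le (R : realType) d (L : R) (u v : 'rV[R]_d) :
  0 < L -> enorm u <= L * enorm v -> dotprod u v <= L * dotprod v v.
Proof.
move=> L0 uLv.
have : enorm u ^+ 2 <= (L * enorm v) ^+ 2.
  by rewrite ler_sqr ?nnegrE ?mulr_ge0 ?sqrtr_ge0 // ltW.
rewrite exprMn !enorm_sqr => uv.
have := dotprod_young _ _ L u v => young.
rewrite -(ler_pM2l (_ : 0 < 2 * L)); lra.
Qed.

(** * Descent and gradient bounds *)

(** Convexity bounds [f y - f x] by [<grad f y, y - x>]; smoothness then trades
    [grad f y] for [grad f x].  This costs a factor 2 in the quadratic term with
    respect to integration along the segment, which only affects constants. *)
Lemma descent (R : realType) (H0 H1 mu : R) d (f : 'rV[R]_d -> R) (fstar : R)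
    (x y : 'rV[R]_d) :
  0 < H0 -> 0 < H1 -> 0 < mu -> fstar <= f x ->
  H0H1_smooth f fstar H0 H1 -> strongly_convex f mu ->
  H1 * dotprod (y - x) (y - x) <= 1 ->
  f y <= f x + dotprod (grad f x) (y - x)
         + (H0 + H1 * (f x - fstar)) * dotprod (y - x) (y - x).
Proof.
move=> H00 H10 mu0 Fx sm sc near_xy.
have L0 : 0 < H0 + H1 * (f x - fstar).
  by rewrite ltr_pwDl // mulr_ge0 ?subr_ge0 // ltW.
have /sm : enorm (y - x) <= 1 / Num.sqrt H1.
  rewrite ler_pdivlMr ?sqrtr_gt0 // /enorm -sqrtrM ?dotprod_ge0 //.
  by rewrite -[leRHS]sqrtr1 ler_wsqrtr // mulrC.
move=> /(dotprod_le_of_enorm_le _ _ _ _ _ L0) cross.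
have grad_split : dotprod (grad f y) (y - x) =
    dotprod (grad f y - grad f x) (y - x) + dotprod (grad f x) (y - x).
  by rewrite -dotprodDl subrK.
have := sc y x; rewrite enorm_sqr.
have : 0 <= mu / 2 * dotprod (y - x) (y - x).
  by rewrite mulr_ge0 ?dotprod_ge0 // divr_ge0 // ltW.
by move: cross; rewrite grad_split; lra.
Qed.

Lemma descent_along_grad (R : realType) (H0 H1 mu : R) d (f : 'rV[R]_d -> R)
    (fstar : R) (x : 'rV[R]_d) (t : R) :
  0 < H0 -> 0 < H1 -> 0 < mu -> fstar <= f x ->
  H0H1_smooth f fstar H0 H1 -> strongly_convex f mu ->
  H1 * (t ^+ 2 * dotprod (grad f x) (grad f x)) <= 1 ->
  f (x - t *: grad f x) <= f x
    - t * (1 - t * (H0 + H1 * (f x - fstar))) * dotprod (grad f x) (grad f x).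
Proof.
move=> H00 H10 mu0 Fx sm sc near_t.
have step_eq : x - t *: grad f x - x = (- t) *: grad f x.
  by rewrite addrAC subrr add0r scaleNr.
have step_sqr : dotprod ((- t) *: grad f x) ((- t) *: grad f x) =
    t ^+ 2 * dotprod (grad f x) (grad f x).
  by rewrite dotprodZl dotprodZr; ring.
have := @descent R H0 H1 mu d f fstar x (x - t *: grad f x) H00 H10 mu0 Fx sm sc.
rewrite step_eq step_sqr dotprodZr => /(_ near_t); lra.
Qed.

(** The gradient step of length [1 / (2 L)] cannot go below the minimum.  It is
    legitimate because it stays in the ball of radius [1 / sqrt H1]: otherwise
    the step that reaches the boundary of the ball would already decrease [f]
    by more than [F]. *)
Lemma grad_sqr_le (R : realType) (H0 H1 mu : R) d (f : 'rV[R]_d -> R)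
    (fstar : R) (x : 'rV[R]_d) :
  0 < H0 -> 0 < H1 -> 0 < mu -> (forall y, fstar <= f y) ->
  H0H1_smooth f fstar H0 H1 -> strongly_convex f mu ->
  dotprod (grad f x) (grad f x)
    <= 4 * (H0 + H1 * (f x - fstar)) * (f x - fstar).
Proof.
move=> H00 H10 mu0 fmin sm sc.
have dec t := @descent_along_grad R H0 H1 mu d f fstar x t H00 H10 mu0 (fmin x) sm sc.
have low t := fmin (x - t *: grad f x).
have F0 : 0 <= f x - fstar by rewrite subr_ge0.
have HF0 : 0 <= H1 * (f x - fstar) by rewrite mulr_ge0 // ltW.
move: (dotprod_ge0 _ _ (grad f x)) dec.
set q := dotprod _ _; set L := H0 + _ => q0 dec.
have L0 : 0 < L by rewrite /L; lra.
have [small|large] := leP (H1 * q) (4 * L ^+ 2).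
- have : H1 * ((1 / (2 * L)) ^+ 2 * q) <= 1.
    have -> : H1 * ((1 / (2 * L)) ^+ 2 * q) = (H1 * q) / (4 * L ^+ 2).
      by field; lra.
    by rewrite ler_pdivrMr ?mul1r // mulr_gt0 // exprn_gt0.
  move/dec; have -> : 1 / (2 * L) * (1 - 1 / (2 * L) * L) * q = q / (4 * L).
    by field; lra.
  move=> dect.
  have qF : q / (4 * L) <= f x - fstar by have := low (1 / (2 * L)); lra.
  by move: qF; rewrite ler_pdivrMr; lra.
- have Hq0 : 0 < H1 * q by apply: lt_trans large; rewrite mulr_gt0 // exprn_gt0.
  have q_gt0 : 0 < q by rewrite pmulr_rgt0 in Hq0.
  pose s := Num.sqrt (H1 * q).
  have s0 : 0 < s by rewrite sqrtr_gt0.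
  have sE : s ^+ 2 = H1 * q by rewrite sqr_sqrtr // ltW.
  have sL : 2 * L < s.
    rewrite -ltr_sqr ?nnegrE ?(ltW s0) ?mulr_ge0 ?(ltW L0) // sE exprMn.
    by move: large; lra.
  have : H1 * ((1 / s) ^+ 2 * q) <= 1.
    have -> : H1 * ((1 / s) ^+ 2 * q) = (H1 * q) / s ^+ 2 by field; lra.
    by rewrite sE divff // lt0r_neq0.
  move/dec; have -> : 1 / s * (1 - 1 / s * L) * q = (s - L) * (q / s ^+ 2).
    by field; lra.
  have -> : q / s ^+ 2 = 1 / H1 by rewrite sE; field; lra.
  move=> dect.
  have : (s - L) / H1 <= f x - fstar by have := low (1 / s); lra.
  by rewrite ler_pdivrMr //; move: sL; rewrite /L; lra.
Qed.

(** The Polyak-Lojasiewicz inequality: strong convexity bounds [f x - f z] by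
    [<g, v> - mu / 2 |v|^2] with [v = x - z], which is at most [|g|^2 / (2 mu)]
    for every [v]. *)
Lemma PL_inequality (R : realType) (mu : R) d (f : 'rV[R]_d -> R)
    (x z : 'rV[R]_d) :
  0 < mu -> strongly_convex f mu ->
  2 * mu * (f x - f z) <= dotprod (grad f x) (grad f x).
Proof.
move=> mu0 /(_ x z); rewrite enorm_sqr => sc.
have := dotprod_young _ _ mu (grad f x) (x - z).
have : 2 * mu * (f x - f z + mu / 2 * dotprod (x - z) (x - z))
       <= 2 * mu * dotprod (grad f x) (x - z).
  by rewrite ler_pM2l //; lra.
lra.
Qed.

(** * Gradient descent with the warm-up step *)

Lemma theta_gt0 (R : realType) : 0 < theta R.
Proof. by have := sqrtr_ge0 (2 : R); rewrite /theta divr_gt0 //; lra. Qed.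

Lemma theta_le (R : realType) : theta R <= 1 / 8.
Proof.
have s1 : (1 : R) <= Num.sqrt 2 by rewrite -[leLHS]sqrtr1 ler_wsqrtr //; lra.
by rewrite /theta ler_pdivrMr; lra.
Qed.

(** The last clause says that one of the two upper bounds is attained; it is
    what makes the step long enough. *)
Lemma warmup_stepP (R : realType) (th H0 H1 F : R) :
  0 < th -> 0 < H0 -> 0 < H1 -> 0 <= F ->
  let eta := warmup_step th H0 H1 F in
  [/\ 0 < eta, eta * H0 <= th, eta * (3 * H1 * F) <= th &
      eta * H0 = th \/ eta * (3 * H1 * F) = th].
Proof.
move=> th0 H00 H10 F0 /=; rewrite /warmup_step.
have pos a : 0 < a -> 0 < th * (1 / a).
  by move=> a0; apply: mulr_gt0 => //; apply: divr_gt0.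
have attained a : 0 < a -> th * (1 / a) * a = th by move=> a0; field; lra.
case: eqVneq => [->|Fn0].
  rewrite !mulr0 attained //.
  by split; [exact: pos | | exact: ltW | left].
have Fgt0 : 0 < F by rewrite lt_neqAle eq_sym Fn0.
have HF0 : 0 < 3 * H1 * F by rewrite !mulr_gt0.
have shrink a b : 0 < a -> 0 < b -> 1 / a <= 1 / b -> th * (1 / a) * b <= th.
  move=> a0 b0 ab; rewrite -[leRHS](attained b) // ler_pM2r // ler_pM2l //.
case: (leP (1 / H0)) => ab.
- split; [exact: pos | by rewrite attained |
          exact: shrink | by left; rewrite attained].
- split; [exact: pos | exact: shrink (ltW ab) |
          by rewrite attained | by right; rewrite attained].
Qed.

Lemma gd_step (R : realType) (H0 H1 mu : R) d (f : 'rV[R]_d -> R)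
    (fstar : R) (x : 'rV[R]_d) (eta : R) :
  0 < H0 -> 0 < H1 -> 0 < mu -> is_min_value f fstar ->
  H0H1_smooth f fstar H0 H1 -> strongly_convex f mu ->
  eta = warmup_step (theta R) H0 H1 (f x - fstar) ->
  f (x - eta *: grad f x) - fstar
    <= (f x - fstar) - eta * mu * (f x - fstar).
Proof.
move=> H00 H10 mu0 [[z fz] fmin] sm sc etaE.
have F0 : 0 <= f x - fstar by rewrite subr_ge0.
have th0 := theta_gt0 R; have th8 := theta_le R.
have [eta0 etaH0 etaH1 _] := @warmup_stepP R _ _ _ _ th0 H00 H10 F0.
have := @PL_inequality R mu d f x z mu0 sc; rewrite fz.
have := @grad_sqr_le R H0 H1 mu d f fstar x H00 H10 mu0 fmin sm sc.
have := @descent_along_grad R H0 H1 mu d f fstar x eta H00 H10 mu0 (fmin x) sm sc.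
rewrite -etaE in eta0 etaH0 etaH1.
move: (dotprod_ge0 _ _ (grad f x)); set q := dotprod _ _.
set F := f x - fstar in F0 etaH1 *; set L := H0 + _ => q0 dec qL PL.
have etaL : eta * L <= 1 / 2 by rewrite /L; lra.
have etaL0 : 0 <= eta * L.
  by rewrite mulr_ge0 ?(ltW eta0) // /L addr_ge0 ?mulr_ge0 // ltW.
have etaHF0 : 0 <= eta * (H1 * F) by rewrite !mulr_ge0 // ltW.
have /dec decr : H1 * (eta ^+ 2 * q) <= 1.
  have H1eta : 0 <= H1 * eta ^+ 2 by rewrite mulr_ge0 ?sqr_ge0 // ltW.
  have := ler_wpM2l H1eta qL.
  have : (eta * L) * (eta * (H1 * F)) <= (1 / 2) * (1 / 2).
    by apply: ler_pM => //; lra.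
  lra.
have slack : 0 <= (1 / 2 - eta * L) * (eta * q).
  by rewrite !mulr_ge0 ?subr_ge0 // ltW.
have PLeta := ler_wpM2l (ltW eta0) PL.
have : f (x - eta *: grad f x) <= f x - eta * q / 2 by lra.
by move: PLeta; rewrite /F; lra.
Qed.

(** Whichever of the two bounds on the step is attained, the corresponding term
    of the potential decreases by [th * mu], and the other term does not
    increase. *)
Lemma potential_step (R : realType) (th H0 H1 mu eta F F' : R) :
  0 < H0 -> 0 < H1 -> 0 < mu -> 0 < eta ->
  eta * H0 = th \/ eta * (3 * H1 * F) = th ->
  0 < F -> 0 < F' -> F' <= F - eta * mu * F ->
  H0 * ln F' + 3 * H1 * F' + th * mu <= H0 * ln F + 3 * H1 * F.
Proof.
move=> H00 H10 mu0 eta0 attained F0 F'0 dec.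
have etamuF0 : 0 <= eta * mu * F by rewrite !mulr_ge0 // ltW.
have ln_dec : ln F' <= ln F - eta * mu.
  have FF' : F' / F <= 1 - eta * mu by rewrite ler_pdivrMr //; lra.
  have : ln (F' / F) <= F' / F - 1.
    have := @le_ln1Dx R (F' / F - 1); rewrite addrCA subrr addr0; apply.
    by rewrite ltrBrDr addNr divr_gt0.
  by rewrite ln_div ?posrE //; lra.
have lnH := ler_wpM2l (ltW H00) ln_dec.
have decH : H1 * F' <= H1 * (F - eta * mu * F) by rewrite ler_pM2l.
have etamu0 : 0 <= H0 * (eta * mu) by rewrite !mulr_ge0 // ltW.
have HetamuF0 : 0 <= H1 * (eta * mu * F) by rewrite mulr_ge0 // ltW.
by case: attained => <-; lra.
Qed.

(** * Iteration complexity *)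

Theorem theoremC19 (R : realType) :
  exists C : R, 0 < C /\
    forall (H0 H1 mu : R) (d : nat) (f : 'rV[R]_d -> R) (fstar : R)
      (x : nat -> 'rV[R]_d),
      0 < H0 -> 0 < H1 -> 0 < mu ->
      (forall y : 'rV[R]_d, differentiable f y) ->
      is_min_value f fstar ->
      H0H1_smooth f fstar H0 H1 ->
      strongly_convex f mu ->
      gradient_descent f
        (fun k => warmup_step (theta R) H0 H1 (f (x k) - fstar)) x ->
      forall eps : R, 0 < eps -> eps < f (x 0%N) - fstar ->
      forall N : nat,
        C * (H0 / (theta R * mu) * ln ((f (x 0%N) - fstar) / eps)
             + H1 * (f (x 0%N) - fstar) / (theta R * mu)) <= N%:R ->
        f (x N) - fstar <= eps.
Proof.
exists 3; split; first by lra.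
move=> H0 H1 mu d f fstar x H00 H10 mu0 _ fmin sm sc gd eps eps0 epsF N leN.
have th0 := theta_gt0 R.
have thmu0 : 0 < theta R * mu by rewrite mulr_gt0.
pose F k := f (x k) - fstar.
have F_ge0 k : 0 <= F k by rewrite subr_ge0; case: fmin.
pose eta k := warmup_step (theta R) H0 H1 (F k).
have dec k : F k.+1 <= F k - eta k * mu * F k.
  by rewrite {1}/F gd; apply: (@gd_step R H0 H1 mu).
(* If the gap exceeds [eps] at step [k], it does so at all earlier steps, by
   monotonicity; all logarithms below are thus taken at positive points. *)
have potential k : eps < F k ->
    H0 * ln (F k) + 3 * H1 * F k + k%:R * (theta R * mu)
    <= H0 * ln (F 0%N) + 3 * H1 * F 0%N.
  elim: k => [|k IHk] Fk1; first by rewrite mul0r addr0.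
  have [eta0 _ _ attained] := @warmup_stepP R _ _ _ _ th0 H00 H10 (F_ge0 k).
  have Fk : eps < F k.
    apply: lt_le_trans Fk1 (le_trans (dec k) _).
    by rewrite gerBl mulr_ge0 // mulr_ge0 // ltW.
  have Fk0 := lt_trans eps0 Fk; have Fk10 := lt_trans eps0 Fk1.
  have := @potential_step R _ _ _ _ _ _ _ H00 H10 mu0 eta0 attained Fk0 Fk10 (dec k).
  by have := IHk Fk; rewrite -natr1; lra.
rewrite leNgt; apply/negP => epsFN.
have FN0 := lt_trans eps0 epsFN.
have F00 : 0 < F 0%N := lt_trans eps0 epsF.
have ln_eps : H0 * ln eps <= H0 * ln (F N).
  by rewrite ler_pM2l // ler_ln ?posrE // ltW.
have ln_ratio : 0 <= H0 * (ln (F 0%N) - ln eps).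
  by rewrite mulr_ge0 ?(ltW H00) // subr_ge0 ler_ln ?posrE // ltW.
have HFN : 0 < H1 * F N by rewrite mulr_gt0.
have := potential N epsFN.
move: leN; rewrite -/(F 0%N) ln_div ?posrE // -(ler_pM2r thmu0).
have -> : 3 * (H0 / (theta R * mu) * (ln (F 0%N) - ln eps) +
    H1 * F 0%N / (theta R * mu)) * (theta R * mu) =
    3 * (H0 * (ln (F 0%N) - ln eps)) + 3 * H1 * F 0%N.
  by field; rewrite !gt_eqF.
lra.
Qed.
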